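(* Let $q$ be a prime power with $q\equiv 2\pmod 3$, and let $\mathcal{F}_q$ be the 1-factorisation of $K_{q+1}^3$ defined in the context. Then $\mathcal{F}_q$ is a connected 1-factorisation if and only if $q\in\{2,5,11\}$ or $q=2^p$ for some odd prime $p$.
   Context: Let $q$ be a prime power with $q\equiv 2\pmod 3$, let $\mathbb{F}=\mathbb{F}_q$ be the field of order $q$, $\mathbb{F}^*=\mathbb{F}\setminus\{0\}$, and $V=\mathbb{F}\cup\{\infty\}$. $K_{q+1}^3$ denotes the complete 3-uniform hypergraph on the vertex set $V$: its edges are all 3-element subsets of $V$. A 1-factor of a hypergraph is a spanning 1-regular subhypergraph (i.e. a set of edges partitioning the vertex set); a 1-factorisation is a partition of the edge set into 1-factors. For $\alpha\in\mathbb{F}^*$, $\beta\in\mathbb{F}$ define $m_{\alpha,\beta}:V\to V$ by $m_{\alpha,\beta}(x)=\beta+\frac{\alpha^2}{\alpha+\beta-x}$ for $x\in\mathbb{F}\setminus\{\alpha+\beta\}$, $m_{\alpha,\beta}(\alpha+\beta)=\infty$, $m_{\alpha,\beta}(\infty)=\beta$. Each $m_{\alpha,\beta}$ is a fixed-point-free permutation of $V$ of order 3. Set $F_{\alpha,\beta}=\{\{x,m_{\alpha,\beta}(x),m_{\alpha,\beta}^{-1}(x)\}\mid x\in V\}$, which is a 1-factor of $K_{q+1}^3$, and $\mathcal{F}_q=\{F_{\alpha,\beta}\mid \alpha\in\mathbb{F}^*,\ \beta\in\mathbb{F}\}$ (as a set, so that coinciding 1-factors are counted once; in fact $F_{\alpha,\beta}=F_{-\alpha,\alpha+\beta}$).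 It is known (Chen and Lu) that $\mathcal{F}_q$ is a 1-factorisation of $K_{q+1}^3$ (for $q=2$ it is the trivial one, with a single 1-factor). A path between vertices $x,y$ of a hypergraph is an alternating sequence $[x=v_1,e_1,v_2,\dots,v_s,e_s,v_{s+1}=y]$ of distinct vertices $v_i$ and distinct edges $e_i$ with $\{v_i,v_{i+1}\}\subseteq e_i$ for $1\le i\le s$. A hypergraph is connected if every two vertices have a path between them. The union of two 1-factors is the hypergraph on $V$ whose edges are those of the two 1-factors. A connected 1-factorisation is a 1-factorisation for which the union of each pair of distinct 1-factors is a connected hypergraph. *)

(* Defs.v *)
From mathcomp Require Import all_boot all_algebra.
Set Implicit Arguments.
Unset Strict Implicit.
Unset Printing Implicit Defensive.
Import GRing.Theory.

Section Hypergraphs.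

(* A hypergraph on the vertex set T is given by its set of edges
   H : {set {set T}}; every element of T is a vertex. *)
Variable T : finType.
Implicit Types (H M : {set {set T}}) (P : {set {set {set T}}}).

Definition complete3 : {set {set T}} := [set e : {set T} | #|e| == 3].

Definition one_factor H M : bool := (M \subset H) && partition M [set: T].

Definition one_factorisation H P : bool :=
  partition P H && [forall M in P, one_factor H M].

(* The path [v_1, e_1, ..., v_s, e_s, v_(s+1)] is encoded by
   x = v_1, vs = [:: v_2; ...; v_(s+1)] and es = [:: e_1; ...; e_s]. *)
Definition hpath H (x y : T) (vs : seq T) (es : seq {set T}) : Prop :=
  [/\ size vs = size es,
      last x vs = y,
      uniq (x :: vs),
      uniq es
    & {subset es <= H} /\
      forall i, i < size es ->
        [set nth x (x :: vs) i; nth x (x :: vs) i.+1] \subset nth set0 es i].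

Definition hconnected H : Prop :=
  forall x y : T, x != y -> exists vs es, hpath H x y vs es.

Definition connected_one_factorisation H P : Prop :=
  one_factorisation H P /\
  forall M N, M \in P -> N \in P -> M != N -> hconnected (M :|: N).

End Hypergraphs.

Section ChenLu.

Local Open Scope ring_scope.

(* V = F \cup {oo} is option F, with None as the point at infinity. *)
Variable F : finFieldType.

Definition mob (a b : F) (v : option F) : option F :=
  match v with
  | Some x => if x == a + b then None else Some (b + a ^+ 2 / (a + b - x))
  | None => Some b
  end.

Lemma mob_inj (a b : F) : a != 0 -> injective (mob a b).
Proof.
move=> a0.
have d0 x : x != a + b -> a + b - x != 0 by rewrite subr_eq0 eq_sym.
have nb x : x != a + b -> b + a ^+ 2 / (a + b - x) != b.
  move=> hx; rewrite -subr_eq0 addrC addKr.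
  by rewrite mulf_neq0 ?invr_eq0 ?expf_neq0 ?d0.
move=> [x|] [y|] //=.
- case: eqP => [->|/eqP hx]; case: eqP => [->|/eqP hy] // [].
  move=> /addrI /(mulfI (expf_neq0 2 a0)) /invr_inj /addrI /oppr_inj ->.
  by [].
- by case: eqP => // /eqP hx [] e; have := nb _ hx; rewrite e eqxx.
- by case: eqP => // /eqP hx [] e; have := nb _ hx; rewrite -e eqxx.
Qed.

(* For an injective f, finv f is the inverse of f; mobK and mobVK confirm
   that this is the case for mob a b when a != 0. *)
Definition factor (a b : F) : {set {set option F}} :=
  [set [set v; mob a b v; finv (mob a b) v] | v : option F].

Lemma mobK (a b : F) : a != 0 -> cancel (mob a b) (finv (mob a b)).
Proof. by move=> a0; apply/finv_f/mob_inj. Qed.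

Lemma mobVK (a b : F) : a != 0 -> cancel (finv (mob a b)) (mob a b).
Proof. by move=> a0; apply/f_finv/mob_inj. Qed.

Definition chen_lu : {set {set {set option F}}} :=
  [set factor a b | a in [set~ 0], b in [set: F]].

End ChenLu.

(* Main.v *)
Require Import Defs.
From mathcomp Require Import all_boot all_algebra all_fingroup all_solvable all_field.
From mathcomp Require Import ring.
Set Implicit Arguments.
Unset Strict Implicit.
Unset Printing Implicit Defensive.
Import GRing.Theory.
Local Open Scope ring_scope.

(** The map [mob a b] is an element of order 3 of PGL(2,q) acting on the
    projective line V = PG(1,q), and the edges of [factor a b] are its orbits. So
    [factor a b] depends only on the subgroup generated by [mob a b], and the
    union of two 1-factors is connected exactly when no proper nonempty subset
    of V is invariant under both maps ([connected_transitive2]), that is, when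
    the group they generate is transitive on V. As q = 2 mod 3, the form
    x^2 + xy + y^2 is anisotropic; hence the maps have no fixed point, and
    moving one point of an edge to infinity shows that every triple lies on
    exactly one factor ([chen_lu_factorisation]).

    Intransitive pairs. If q is odd, two of the maps generate a group Alt(4)
    ([tetrahedral_exists], by counting squares on a conic); its orbits have at
    most 12 points, so that q + 1 <= 12 and q is 5 or 11. If q = 2^n and d is a
    proper divisor of n, d > 1, two maps with parameters in the subfield of
    order 2^d preserve the subline over that field ([subline_disconnected]).
    Since q = 2 mod 3 forces n to be odd, what remains for even q is n = 1 and
    n an odd prime.

    Transitivity for q = 2, 5, 11. An invariant set or its complement has at
    most six points, which makes some orbit of one map share two points with an
    orbit of the other. With one of these at infinity the pair becomes
    [mob 1 0], [mob z 0], and an invariant set of at most six points around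
    infinity is impossible by a direct computation, unless it has exactly six
    points and -1 is a square or 5 = 0 ([shared_arc_at_infinity]).

    Transitivity for q = 2^p. Two maps of order 3 are inverted by a common
    involution, whose fixed point may be moved to infinity; the pair becomes
    [mob 1 0], [mob 1 b] and the involution becomes x + 1. Let G be the group
    generated by these three maps. A count of involutions in the manner of
    Bender, which compares those fixing a point of the orbit of infinity with
    those exchanging infinity and another point, shows that the two-point
    stabilisers in G act simply transitively on the nontrivial translations in G
    ([card_swaps]). So the l for which x + l belongs to G form a subring of the
    field. It contains b, which is neither 0 nor 1; as the degree p is prime the
    subring is the whole field ([subring_full]), and G contains all translations
    and moves infinity. Finally an orbit of the group generated by the two maps
    alone is as large, because x + 1 normalises that group and fixes
    infinity. *)

(** * Moebius maps of the projective line *)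

Section Moebius.

Variable F : finFieldType.
Implicit Types (a b c d k x y P : F) (v w : option F) (S : {set option F}).

(** The point with homogeneous coordinates (x : y). *)
Definition proj x y : option F := if y == 0 then None else Some (x / y).

Definition moebius a b c d v : option F :=
  if v is Some x then proj (a * x + b) (c * x + d) else proj a c.

Lemma proj_scale k x y : k != 0 -> proj (k * x) (k * y) = proj x y.
Proof.
move=> k0; rewrite /proj mulf_eq0 (negPf k0) /=; case: eqP => // _.
by rewrite -mulf_div divff // mul1r.
Qed.

Lemma moebius_scale k a b c d v :
  k != 0 -> moebius (k * a) (k * b) (k * c) (k * d) v = moebius a b c d v.
Proof.
by move=> k0; case: v => [x|] /=; rewrite -?mulrA -?mulrDr proj_scale.
Qed.

Lemma moebius_proj a b c d x y : (x != 0) || (y != 0) ->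
  moebius a b c d (proj x y) = proj (a * x + b * y) (c * x + d * y).
Proof.
rewrite /proj; case: (eqVneq y 0) => [-> /=|y0 _ /=].
  rewrite orbF => x0; rewrite !mulr0 !addr0 -[RHS](@proj_scale x^-1) ?invr_eq0 //.
  by rewrite ![x^-1 * _]mulrC !mulfK.
rewrite -[LHS](@proj_scale y) //.
by congr proj; field.
Qed.

Lemma moebius_comp a b c d a' b' c' d' v : a' * d' - b' * c' != 0 ->
  moebius a b c d (moebius a' b' c' d' v) =
  moebius (a * a' + b * c') (a * b' + b * d')
          (c * a' + d * c') (c * b' + d * d') v.
Proof.
move=> D0; case: v => [x|] /=; rewrite moebius_proj //.
- by congr proj; ring.
- apply: contraNT D0; rewrite negb_or !negbK => /andP[/eqP e1 /eqP e2].
  have [c0|c0] := eqVneq c' 0.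
    have d0 : d' = 0 by move: e2; rewrite c0 mul0r add0r.
    by rewrite c0 d0 !mulr0 subrr.
  suff -> : a' * d' - b' * c' = a' * (c' * x + d') - c' * (a' * x + b').
    by rewrite e1 e2 !mulr0 subrr.
  by ring.
- apply: contraNT D0; rewrite negb_or !negbK => /andP[/eqP -> /eqP ->].
  by rewrite mul0r mulr0 subrr.
Qed.

Lemma moebius_id a v : a != 0 -> moebius a 0 0 a v = v.
Proof.
move=> a0; case: v => [x|] /=; rewrite /proj ?mul0r ?add0r ?addr0 ?eqxx //.
by rewrite (negPf a0) mulrC mulKf.
Qed.

Lemma mobE a b v :
  mob a b v = moebius (- b) (a ^+ 2 + a * b + b ^+ 2) (- 1) (a + b) v.
Proof.
case: v => [x|] /=; rewrite /proj; last first.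
  by rewrite oppr_eq0 oner_eq0 divrNN divr1.
have -> : - 1 * x + (a + b) = a + b - x by ring.
rewrite subr_eq0 eq_sym; case: eqP => // /eqP n.
have d0 : a + b - x != 0 by rewrite subr_eq0.
by congr Some; field.
Qed.

Lemma mob_det a b : - b * (a + b) - (a ^+ 2 + a * b + b ^+ 2) * (- 1) = a ^+ 2.
Proof. by ring. Qed.

Lemma mob_det_neq0 a b : a != 0 ->
  - b * (a + b) - (a ^+ 2 + a * b + b ^+ 2) * (- 1) != 0.
Proof. by move=> a0; rewrite mob_det expf_neq0. Qed.

Lemma mob3 a b v : a != 0 -> mob a b (mob a b (mob a b v)) = v.
Proof.
move=> a0; rewrite !mobE !moebius_comp ?mob_det_neq0 //.
rewrite -[RHS](@moebius_id (- a ^+ 3)) ?oppr_eq0 ?expf_neq0 //.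
by congr moebius; ring.
Qed.

Lemma finv_mob a b v : a != 0 -> finv (mob a b) v = mob a b (mob a b v).
Proof.
by move=> a0; apply: (mob_inj (b := b) a0); rewrite mobVK // mob3.
Qed.

(** The inverse of a generator of order 3 is again of the form [mob]; this is
    why two parameter pairs name the same 1-factor. *)
Lemma mob_opp a b v : a != 0 -> mob (- a) (a + b) v = mob a b (mob a b v).
Proof.
move=> a0; rewrite !mobE moebius_comp ?mob_det_neq0 //.
rewrite -[RHS](@moebius_scale a^-1) ?invr_eq0 //.
by congr moebius; field.
Qed.

Lemma mob_opp2 a b v : a != 0 -> mob (- a) (a + b) (mob (- a) (a + b) v) = mob a b v.
Proof. by move=> a0; rewrite !mob_opp // mob3. Qed.

Lemma mob2_None a b : a != 0 -> mob a b (mob a b None) = Some (a + b).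
Proof. by move=> a0; rewrite -mob_opp. Qed.

(** * Changes of coordinate *)

(** The involution P + 1 / (x - P), which exchanges P and infinity. *)
Definition inversion P : option F -> option F := moebius P (1 - P ^+ 2) 1 (- P).

Lemma inversion_self P : inversion P (Some P) = None.
Proof. by rewrite /= /proj mul1r subrr eqxx. Qed.

Lemma inversionK P : involutive (inversion P).
Proof.
move=> v; rewrite /inversion moebius_comp; last first.
  by rewrite (_ : _ - _ = -1) ?oppr_eq0 ?oner_eq0 //; ring.
by rewrite -[RHS](@moebius_id 1) ?oner_eq0 //; congr moebius; ring.
Qed.

(** The quadratic polynomial in P whose roots are the fixed points of
    [mob a b]. *)
Definition qform a b P := (P - b) ^+ 2 - a * (P - b) + a ^+ 2.

Lemma inversion_mob P a b v : a != 0 -> qform a b P != 0 ->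
  inversion P (mob a b v) =
  mob (- a / qform a b P) (P + (a + b - P) / qform a b P) (inversion P v).
Proof.
move=> a0 Q0; rewrite /inversion !mobE !moebius_comp ?mob_det_neq0 //; last first.
  by rewrite (_ : _ - _ = -1) ?oppr_eq0 ?oner_eq0 //; ring.
rewrite -[RHS](@moebius_scale (- qform a b P)) ?oppr_eq0 //.
congr moebius; rewrite /qform; field; exact: Q0.
Qed.

Definition rescale a b : option F -> option F := moebius 1 (- b) 0 a.

Lemma rescale_mob a b c d v : a != 0 -> c != 0 ->
  rescale a b (mob c d v) = mob (c / a) ((d - b) / a) (rescale a b v).
Proof.
move=> a0 c0; rewrite /rescale !mobE !moebius_comp ?mob_det_neq0 //; last first.
  by rewrite mulr0 subr0 mul1r.
rewrite -[RHS](@moebius_scale a) //.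
by congr moebius; field.
Qed.

Lemma rescale_bij a b : a != 0 -> bijective (rescale a b).
Proof.
move=> a0; exists (moebius a b 0 1) => v; rewrite /rescale moebius_comp.
- by rewrite -[RHS](@moebius_id a) //; congr moebius; ring.
- by rewrite mulr0 subr0 mul1r.
- by rewrite -[RHS](@moebius_id a) //; congr moebius; ring.
- by rewrite mulr0 subr0 mulr1.
Qed.

End Moebius.

(** * Fields of order 2 modulo 3 *)

Section Mod3.

Variable F : finFieldType.

Lemma card_pchar p : p \in [pchar F] -> exists2 n, (0 < n)%N & #|F| = (p ^ n)%N.
Proof.
move=> ch; have e : #|F| = (p ^ logn p #|F|)%N := card_pprimeChar ch.
exists (logn p #|F|) => //; rewrite lt0n; apply: contraTneq (finRing_gt1 F).
by move=> e0; rewrite e e0.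
Qed.

Lemma prime_natr_neq0 p : prime p -> ~~ (p %| #|F|)%N -> p%:R != 0 :> F.
Proof.
move=> pr; apply: contraNneq => p0.
have ch : p \in [pchar F] by rewrite inE /= pr p0 eqxx.
by have [n n0 ->] := card_pchar ch; apply: dvdn_exp.
Qed.

Hypothesis qmod3 : #|F| = 2 %[mod 3].
Implicit Types (a b c d k x y z P : F) (v w : option F) (S : {set option F}).

Lemma three_neq0 : 3%:R != 0 :> F.
Proof.
by apply: prime_natr_neq0; rewrite // /dvdn qmod3.
Qed.

(** Cubing is injective on the multiplicative group, of order 1 modulo 3. *)
Lemma cube_root_unity x : x ^+ 3 = 1 -> x = 1.
Proof.
move=> x3; have e := divn_eq #|F| 3; rewrite qmod3 in e.
have x0 : x != 0.
  by apply: contraTneq (oner_neq0 F) => x0; rewrite -x3 x0 expr0n eqxx.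
have := expf_card x; rewrite e /= exprD mulnC exprM x3 expr1n mul1r expr2.
by rewrite -[RHS]mulr1 => /(mulfI x0).
Qed.

(** The form x^2 + xy + y^2 has discriminant -3, and it is anisotropic because
    a nontrivial zero would give a primitive cube root of unity x / y. *)
Lemma anisotropic x y : x ^+ 2 + x * y + y ^+ 2 = 0 -> y = 0.
Proof.
move=> e; apply/eqP/negPn/negP => y0.
have /cube_root_unity r : (x / y) ^+ 3 = 1.
  apply/eqP; rewrite -subr_eq0; apply/eqP.
  transitivity ((x - y) * (x ^+ 2 + x * y + y ^+ 2) / y ^+ 3); first by field.
  by rewrite e mulr0 mul0r.
have exy : x = y by rewrite -[x](divfK y0) r mul1r.
move/eqP: e; rewrite exy -expr2 -!mulr2n -mulrSr -mulr_natr mulf_eq0.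
by rewrite (negPf three_neq0) (negPf (expf_neq0 2 y0)).
Qed.

Lemma qform_neq0 a b P : a != 0 -> qform a b P != 0.
Proof.
move=> a0; apply: contraNneq a0 => e; rewrite -oppr_eq0.
by apply/eqP/(@anisotropic (P - b)); rewrite -[RHS]e /qform; ring.
Qed.

Lemma mob_neq a b v : a != 0 -> mob a b v != v.
Proof.
move=> a0; case: v => [x|//] /=; case: (eqVneq x (a + b)) => // n.
have d0 : a + b - x != 0 by rewrite subr_eq0 eq_sym.
apply: contraNneq (qform_neq0 b x a0) => -[e].
rewrite (_ : qform a b x = (b + a ^+ 2 / (a + b - x) - x) * (a + b - x)).
  by rewrite e subrr mul0r.
by rewrite /qform; field.
Qed.

Lemma mob2_neq a b v : a != 0 -> mob a b (mob a b v) != v.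
Proof.
by move=> a0; apply: contraNneq (mob_neq b v a0) => e; rewrite -{1}e mob3.
Qed.

(** Inversion at P conjugates the set of maps [mob] into itself, so that any
    single point may be moved to infinity. *)
Lemma inversion_conj P a b : a != 0 ->
  exists a' b', a' != 0 /\
    forall v, inversion P (mob a b v) = mob a' b' (inversion P v).
Proof.
move=> a0; have Q0 := qform_neq0 b P a0.
exists (- a / qform a b P), (P + (a + b - P) / qform a b P); split=> [|v].
  by rewrite mulf_neq0 ?oppr_eq0 ?invr_eq0.
exact: inversion_mob.
Qed.

Lemma mob_inj_param a b c d : mob a b =1 mob c d -> a != 0 -> c != 0 ->
  a = c /\ b = d.
Proof.
move=> e a0 c0; have [eb] : Some b = Some d by exact: (e None).
have := e (mob a b None); rewrite [in RHS]e !mob2_None // => -[].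
by rewrite eb => /addIr.
Qed.

(** With v at infinity the two images are b and a + b. *)
Lemma mob_flag a b c d v : a != 0 -> c != 0 ->
  mob a b v = mob c d v -> mob a b (mob a b v) = mob c d (mob c d v) ->
  a = c /\ b = d.
Proof.
move=> a0 c0.
have atoo a1 b1 c1 d1 : a1 != 0 -> c1 != 0 -> mob a1 b1 None = mob c1 d1 None ->
    mob a1 b1 (mob a1 b1 None) = mob c1 d1 (mob c1 d1 None) ->
    a1 = c1 /\ b1 = d1.
  by move=> a10 c10 [->]; rewrite !mob2_None // => -[/addIr].
case: v => [P|]; last exact: atoo.
have [a' [b' [a'0 ea]]] := inversion_conj P b a0.
have [c' [d' [c'0 ec]]] := inversion_conj P d c0.
move=> e1 e2; apply: mob_inj_param => // v; apply: (inv_inj (inversionK P)).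
have [ea' eb'] : a' = c' /\ b' = d'.
  apply: atoo => //; rewrite -(inversion_self P) -!ea -!ec ?e1 //.
  by rewrite -e2 e1.
by rewrite ea ec ea' eb'.
Qed.

Lemma mob_exists u v w : u != v -> v != w -> u != w ->
  exists a b, [/\ a != 0, mob a b u = v & mob a b v = w].
Proof.
have atoo v1 w1 : v1 != None -> v1 != w1 -> w1 != None ->
    exists a b, [/\ a != 0, mob a b None = v1 & mob a b v1 = w1].
  case: v1 w1 => [y|] [z|] // _ n _; exists (z - y), y; split=> //.
  - by rewrite subr_eq0; apply: contraNneq n => ->.
  - have zy : z - y != 0 by rewrite subr_eq0; apply: contraNneq n => ->.
    by have := mob2_None y zy; rewrite /= subrK.
case: u => [P|] nuv nvw nuw; last by apply: atoo => //; rewrite eq_sym.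
have inj := inv_inj (inversionK P).
have [||| a [b [a0 e1 e2]]] := @atoo (inversion P v) (inversion P w).
- by rewrite -(inversion_self P) (inj_eq inj) eq_sym.
- by rewrite (inj_eq inj).
- by rewrite -(inversion_self P) (inj_eq inj) eq_sym.
have [a' [b' [a'0 e]]] := inversion_conj P b a0.
exists a', b'; split=> //; last by rewrite -[v](inversionK P) -e e2 inversionK.
by rewrite -[Some P](inversionK P) -e inversion_self e1 inversionK.
Qed.

End Mod3.

(** * Simple paths in hypergraphs *)

Section Paths.

Variables (T : finType) (H : {set {set T}}).
Implicit Types (x y z : T) (e : {set T}).

Lemma hpath_push x y z e vs es : e \in H -> x \in e -> y \in e ->
  x \notin y :: vs -> e \notin es ->
  hpath H y z vs es -> hpath H x z (y :: vs) (e :: es).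
Proof.
move=> eH xe ye xn en [sz la uv ue [sub inc]]; split=> //.
- by rewrite /= sz.
- by rewrite cons_uniq xn.
- by rewrite cons_uniq en.
split=> [f|[|i] /= hi].
- by rewrite inE => /predU1P[->|/sub].
- by apply/subsetP=> w; rewrite !inE => /orP[]/eqP->.
by rewrite !(set_nth_default y x) ?inc //= sz // ltnW.
Qed.

Lemma hpath_behead x v z e vs es :
  hpath H x z (v :: vs) (e :: es) -> hpath H v z vs es.
Proof.
move=> [/= [sz] la /andP[_ uv] /andP[_ ue] [sub inc]]; split=> //; split.
  by move=> f fe; apply: sub; rewrite inE fe orbT.
move=> i hi; have := inc i.+1 hi => /=.
by rewrite !(set_nth_default v x) //= sz // ltnW.
Qed.

Lemma hpath_drop y z vs es i : (i <= size es)%N -> hpath H y z vs es ->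
  hpath H (nth y (y :: vs) i) z (drop i vs) (drop i es).
Proof.
elim: i y vs es => [|i IH] y vs es; first by rewrite !drop0.
case: es vs => [|e es] [|v vs] //= hi hp; first by case: hp.
have [[sz] _ _ _ _] := hp.
by rewrite (set_nth_default v) /= ?sz //; apply: IH hi (hpath_behead hp).
Qed.

(** Prepending an edge to a path keeps the path simple once the detour through
    a repeated vertex, or through a repeated edge, has been cut out. *)
Lemma hpath_cons x y z e : e \in H -> x \in e -> y \in e ->
  (exists vs es, hpath H y z vs es) -> exists vs es, hpath H x z vs es.
Proof.
move=> eH xe ye [vs [es hp]]; have [sz la uv ue [sub inc]] := hp.
have [xv|xn] := boolP (x \in y :: vs).
  have hi : (index x (y :: vs) <= size es)%N by rewrite -sz -ltnS index_mem.
  by do 2!eexists; have := hpath_drop hi hp; rewrite nth_index //; apply.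
have [ees|en] := boolP (e \in es); last first.
  by exists (y :: vs), (e :: es); apply: hpath_push hp.
have hj : (index e es < size es)%N by rewrite index_mem.
have := inc _ hj; rewrite nth_index // => /subsetP/(_ (nth y (y :: vs) (index e es).+1)).
rewrite !inE eqxx orbT => /(_ isT) we.
have hd := hpath_drop hj hp.
do 2!eexists; apply: (@hpath_push _ _ _ e) hd => //.
  apply: contra xn; rewrite inE => /predU1P[->|/mem_drop xv].
    by apply: mem_nth; rewrite /= sz.
  by rewrite inE xv orbT.
by have := drop_uniq (index e es) ue; rewrite drop_index //= => /andP[].
Qed.

Lemma hpath_stable (S : {set T}) x y vs es :
  (forall e u v, e \in H -> u \in e -> v \in e -> u \in S -> v \in S) ->
  hpath H x y vs es -> x \in S -> y \in S.
Proof.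
move=> st; elim: vs es x => [|v vs IH] [|e es] x hp; have [//= sz la _ _ [sub inc]] := hp.
  by rewrite -la.
move=> xS; apply: IH (hpath_behead hp) _.
have /subsetP /= in0 := inc 0 isT.
by apply: (st e x) => //; [apply: sub|apply: in0|apply: in0]; rewrite !inE eqxx ?orbT.
Qed.

End Paths.

(** * The 1-factorisation *)

Section Factorisation.

Variable F : finFieldType.
Hypothesis qmod3 : #|F| = 2 %[mod 3].
Implicit Types (a b c d : F) (u v w : option F) (S : {set option F}).

Definition orb a b v := [set v; mob a b v; mob a b (mob a b v)].

Lemma factorE a b : a != 0 -> factor a b = [set orb a b v | v : option F].
Proof.
by move=> a0; apply/eq_imset => v; rewrite /orb -finv_mob.
Qed.

Lemma card_orb a b v : a != 0 -> #|orb a b v| = 3.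
Proof.
move=> a0; rewrite /orb -setUA cardsU1 cards2 !inE negb_or.
by rewrite eq_sym mob_neq // eq_sym mob2_neq // eq_sym mob_neq.
Qed.

Lemma orb_self a b v : v \in orb a b v.
Proof. by rewrite !inE eqxx. Qed.

Lemma orb_eq a b v w : a != 0 -> w \in orb a b v -> orb a b w = orb a b v.
Proof.
move=> a0; rewrite !inE -orbA => /or3P[] /eqP -> //; rewrite /orb mob3 //.
  by rewrite setUC setUA.
by rewrite [RHS]setUC setUA.
Qed.

Lemma factor_opp a b : a != 0 -> factor (- a) (a + b) = factor a b.
Proof.
move=> a0; rewrite !factorE ?oppr_eq0 //; apply/eq_imset => v.
by rewrite /orb mob_opp2 // mob_opp // setUAC.
Qed.

Lemma factorP a b (e : {set option F}) : a != 0 ->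
  reflect (exists2 v, v \in e & e = orb a b v) (e \in factor a b).
Proof.
move=> a0; rewrite factorE //; apply: (iffP imsetP) => -[v].
  by move=> _ ->; exists v => //; apply: orb_self.
by exists v.
Qed.

Lemma mem_factor a b v (e : {set option F}) :
  a != 0 -> e \in factor a b -> v \in e -> e = orb a b v.
Proof. by move=> a0 /factorP-/(_ a0)[w _ ->] /orb_eq->. Qed.

Lemma chen_luP (M : {set {set option F}}) :
  reflect (exists a b, a != 0 /\ M = factor a b) (M \in chen_lu F).
Proof.
apply: (iffP imset2P) => [[a b]|[a [b [a0 ->]]]].
  by rewrite !inE => a0 _ ->; exists a, b.
by exists a b; rewrite ?inE.
Qed.

(** An orbit of length 3 carries just two cyclic orders, so it determines the
    generating map up to inversion. *)
Lemma factor_inj a b c d v : a != 0 -> c != 0 -> orb a b v = orb c d v ->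
  (c = a /\ d = b) \/ (c = - a /\ d = a + b).
Proof.
move=> a0 c0 e.
have third x y z : [set v; x; y] = [set v; x; z] -> y != v -> y != x -> y = z.
  move=> /setP/(_ y); rewrite !inE eqxx orbT => /esym/orP[/orP[]/eqP->|/eqP //].
    by rewrite eqxx.
  by rewrite eqxx.
have : mob c d v \in orb a b v by rewrite e !inE eqxx orbT.
rewrite !inE (negPf (mob_neq _ _ _ _)) //= => /orP[]/eqP e1.
  left; apply: (@mob_flag F qmod3 _ _ _ _ v) => //.
  apply: (third (mob c d v)); rewrite ?mob_neq ?mob2_neq //.
  by move: e; rewrite /orb -e1 => ->.
right; apply: (@mob_flag F qmod3 _ _ _ _ v); rewrite ?mob_opp2 ?mob_opp ?oppr_eq0 //.
apply: (third (mob c d v)); rewrite ?mob_neq ?mob2_neq //.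
by move: e; rewrite /orb -e1 setUAC => ->.
Qed.

Lemma factor_inj_pair a b c d : a != 0 -> c != 0 -> factor a b = factor c d ->
  (c = a /\ d = b) \/ (c = - a /\ d = a + b).
Proof.
move=> a0 c0 e; apply: (@factor_inj _ _ _ _ None) => //.
apply: (mem_factor c0); last exact: orb_self.
by rewrite -e; apply/factorP => //; exists None => //; apply: orb_self.
Qed.

Lemma factor_eq a b c d (e : {set option F}) : a != 0 -> c != 0 ->
  e \in factor a b -> e \in factor c d -> factor a b = factor c d.
Proof.
move=> a0 c0 /factorP-/(_ a0)[v ve ea] /mem_factor-/(_ _ c0 ve) ec.
have [[-> ->]|[-> ->]] // : (c = a /\ d = b) \/ (c = - a /\ d = a + b).
  by apply: (@factor_inj _ _ _ _ v); rewrite // -ec.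
by rewrite factor_opp.
Qed.

Lemma factor_one_factor a b : a != 0 ->
  one_factor (complete3 (option F)) (factor a b).
Proof.
move=> a0; apply/andP; split.
  by apply/subsetP=> e /factorP-/(_ a0)[v _ ->]; rewrite inE card_orb.
apply/and3P; split.
- apply/eqP/setP => v; rewrite inE; apply/bigcupP; exists (orb a b v).
    by apply/factorP => //; exists v => //; apply: orb_self.
  exact: orb_self.
- apply/trivIsetP => e f he hf; apply: contraR => /pred0Pn[v /andP[/= ve vf]].
  by rewrite (mem_factor a0 he ve) (mem_factor a0 hf vf).
- by apply/factorP => // -[v]; rewrite inE.
Qed.

Lemma chen_lu_factorisation :
  one_factorisation (complete3 (option F)) (chen_lu F).
Proof.
apply/andP; split; last first.
  by apply/forall_inP => M /chen_luP[a [b [a0 ->]]]; apply: factor_one_factor.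
apply/and3P; split.
- apply/eqP/setP => e; apply/bigcupP/idP => [[M]|].
    case/chen_luP => a [b [a0 ->]] /factorP-/(_ a0)[v _ ->].
    by rewrite inE card_orb.
  rewrite inE; have [[|u [|v [|w []]]] //=] := cards_eqP.
  rewrite !inE negb_or andbT => /andP[/andP[nuv nuw] nvw] _.
  have [a [b [a0 e1 e2]]] := mob_exists qmod3 nuv nvw nuw.
  exists (factor a b); first by apply/chen_luP; exists a, b.
  apply/factorP => //; exists u; first by rewrite !inE eqxx.
  by rewrite /orb e1 e2; apply/setP => x; rewrite !inE orbA.
- apply/trivIsetP => M N /chen_luP[a [b [a0 ->]]] /chen_luP[c [d [c0 ->]]].
  apply: contraR => /pred0Pn[e /andP[/= ea ec]].
  by rewrite (factor_eq a0 c0 ea ec).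
- apply/chen_luP => -[a [b [a0 /setP/(_ (orb a b None))]]].
  rewrite inE => /esym/negP; apply; apply/factorP => //.
  by exists None => //; apply: orb_self.
Qed.

(** * Connectedness through invariant sets *)

Definition closed_under a b S := forall v, v \in S -> mob a b v \in S.

Lemma closed_orb a b S v : closed_under a b S -> v \in S -> orb a b v \subset S.
Proof.
move=> cl vS; apply/subsetP => w; rewrite !inE -orbA => /or3P[]/eqP->//.
  exact: cl.
exact/cl/cl.
Qed.

Lemma closed_compl a b S : a != 0 -> closed_under a b S -> closed_under a b (~: S).
Proof.
move=> a0 cl v; rewrite !inE; apply: contra => vS.
by rewrite -(mob3 b v a0); exact/cl/cl.
Qed.

Definition transitive2 a b c d := forall S v,
  closed_under a b S -> closed_under c d S -> v \in S -> S = setT.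

Lemma connected_transitive2 a b c d : a != 0 -> c != 0 ->
  hconnected (factor a b :|: factor c d) <-> transitive2 a b c d.
Proof.
move=> a0 c0; split=> [con S v ca cc vS|tr x y _].
  apply/setP => y; rewrite inE; have [<-//|nvy] := eqVneq v y.
  have [vs [es hp]] := con v y nvy; apply: (hpath_stable _ hp vS).
  move=> e u w; rewrite inE => /orP[] he ue; move: (ue) => /(mem_factor _ he) -> // we uS.
    exact: subsetP (closed_orb ca uS) _ we.
  exact: subsetP (closed_orb cc uS) _ we.
pose r u w := [exists e in factor a b :|: factor c d, (u \in e) && (w \in e)].
have rorb u w p q : p != 0 -> factor p q \subset factor a b :|: factor c d ->
    w \in orb p q u -> r u w.
  move=> p0 sub wu; apply/exists_inP; exists (orb p q u); last by rewrite orb_self.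
  by apply: (subsetP sub); apply/factorP => //; exists u => //; apply: orb_self.
have cl p q : p != 0 -> factor p q \subset factor a b :|: factor c d ->
    closed_under p q [set w | connect r x w].
  move=> p0 sub w; rewrite !inE => /connect_trans; apply; apply: connect1.
  by apply: rorb sub _; rewrite // !inE eqxx orbT.
have := tr _ x (cl a b a0 (subsetUl _ _)) (cl c d c0 (subsetUr _ _)).
rewrite inE connect0 => /(_ isT)/setP/(_ y); rewrite !inE => /connectP[p + ->].
elim: p x {cl} => [|w p IH] x /=; first by exists [::], [::].
case/andP => /exists_inP[e eH /andP[xe we]] /IH; exact: hpath_cons xe we.
Qed.

End Factorisation.

(** * Disconnected unions: the alternating group of degree 4 *)

(** Two maps of order 3 whose product is an involution satisfy the defining
    relations of the tetrahedral group Alt(4), of order 12. *)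
Lemma tetrahedral_orbit (T : finType) (f g : T -> T) (v : T) :
  (forall x, f (f (f x)) = x) -> (forall x, g (g (g x)) = x) ->
  (forall x, f (g (f (g x))) = x) ->
  exists S : {set T}, [/\ v \in S, (#|S| <= 12)%N,
    forall x, x \in S -> f x \in S & forall x, x \in S -> g x \in S].
Proof.
move=> f3 g3 fg2.
have fgf x : f (g (f x)) = g (g x) by rewrite -{1}(g3 x) fg2.
have gf x : g (f x) = f (f (g (g x))) by rewrite -fgf f3.
have ggff x : g (g (f (f x))) = f (g x).
  by rewrite -[LHS]fg2 g3 f3.
have fgff x : f (g (f (f x))) = g (f (f (g (g x)))) by rewrite fgf gf.
(* The twelve words are the cosets of <g> represented by 1, f, ff and gff. *)
exists [set x in [:: v; g v; g (g v); f v; f (g v); f (g (g v));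
  f (f v); f (f (g v)); f (f (g (g v)));
  g (f (f v)); g (f (f (g v))); g (f (f (g (g v))))]]; split=> [||x|x].
- by rewrite !inE eqxx.
- by rewrite cardsE; apply: leq_trans (card_size _) _.
- rewrite !inE; repeat case/orP; move/eqP=> ->;
    by rewrite ?fgff ?f3 ?g3 eqxx ?orbT.
- rewrite !inE; repeat case/orP; move/eqP=> ->;
    by rewrite ?ggff ?g3 ?eqxx ?orbT // gf ?g3 eqxx ?orbT.
Qed.

Section Tetrahedral.

Variable F : finFieldType.
Hypothesis qmod3 : #|F| = 2 %[mod 3].
Hypothesis two_neq0 : 2%:R != 0 :> F.
Implicit Types (a b x y : F).

(** Each square has at most two roots, and 0 only one. *)
Lemma card_squares : (#|F| < #|[set x ^+ 2 | x : F]|.*2)%N.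
Proof.
set Q := [set x ^+ 2 | x : F]; have Q0 : 0 \in Q.
  by apply/imsetP; exists 0; rewrite ?expr0n.
rewrite -[#|F|]sum1_card (partition_big (fun x : F => x ^+ 2) [in Q]) /=; last first.
  by move=> x _; apply: imset_f.
rewrite (bigD1 0) //= (_ : \sum_(i | _) 1 = 1)%N; last first.
  by rewrite (eq_bigl (pred1 0)) ?big_pred1_eq // => x; rewrite /= sqrf_eq0.
rewrite -muln2 -sum_nat_const [X in (_ < X)%N](bigD1 0) //= -add1n addnA leq_add2l.
apply: leq_sum => _ /andP[/imsetP[r _ ->] _]; rewrite sum1_card.
apply: leq_trans (_ : #|[set r; - r]| <= 2)%N; last by rewrite cards2; case: eqP.
by apply/subset_leq_card/subsetP => x; rewrite !inE -eqf_sqr.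
Qed.

(** A conic over a finite field has a rational point, because more than half
    of the elements are squares. *)
Lemma conic_point : exists x y : F, x ^+ 2 + 3%:R * y ^+ 2 = - 8%:R.
Proof.
have t0 := three_neq0 qmod3; set Q := [set x ^+ 2 | x : F].
pose h y : F := - 8%:R - 3%:R * y.
have hinj : injective h by move=> x y /addrI/oppr_inj/(mulfI t0).
have : ~~ [disjoint Q & h @: Q].
  apply/negP => /disjoint_setI0 dis; have := card_squares; rewrite ltnNge.
  rewrite -addnn -{2}(card_imset Q hinj) -cardsUI dis cards0 addn0.
  by rewrite max_card.
case/pred0Pn=> z /andP[/= /imsetP[x _ ->] /imsetP[_ /imsetP[y _ ->] e]].
by exists x, y; rewrite e /h subrK.
Qed.

(** The condition says that the matrix of the product of [mob 1 0] and
    [mob a b] has trace 0. As a quadratic equation in b it has discriminant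
    -3a^2 + 2a - 3, and this is a square y^2 when 3a - 1 = x and y are the
    coordinates of a point of the conic above. *)
Lemma tetrahedral_exists : exists a b, a != 0 /\ a ^+ 2 + a * b + b ^+ 2 = a + b - 1.
Proof.
have t0 := three_neq0 qmod3; have [x [y e]] := conic_point.
pose a := (x + 1) / 3%:R; pose b := (1 - a + y) / 2%:R.
have eab : a ^+ 2 + a * b + b ^+ 2 = a + b - 1.
  apply/eqP; rewrite -subr_eq0; apply/eqP.
  transitivity ((x ^+ 2 + 3%:R * y ^+ 2 + 8%:R) / 12%:R); last first.
    by rewrite e addNr mul0r.
  have t12 : 12%:R != 0 :> F.
    by rewrite (_ : 12%:R = 2%:R * 2%:R * 3%:R) ?mulf_neq0 //; ring.
  by rewrite /b /a; field; rewrite t12 two_neq0 t0.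
exists a, b; split=> //; apply: contraTneq (oner_neq0 F) => a0; rewrite negbK.
rewrite -oppr_eq0; apply/eqP/(@anisotropic F qmod3 b).
transitivity (a ^+ 2 + a * b + b ^+ 2 - (a + b - 1)); last by rewrite eab subrr.
by rewrite a0; ring.
Qed.

(** A matrix of trace 0 has a scalar square. *)
Lemma tetrahedral_relation a b v :
  a != 0 -> a ^+ 2 + a * b + b ^+ 2 = a + b - 1 ->
  mob 1 0 (mob a b (mob 1 0 (mob a b v))) = v.
Proof.
move=> a0 e.
have e1 w : mob 1 0 (mob a b w) = moebius (- 1) (a + b) (b - 1) 1 w.
  by rewrite !mobE moebius_comp ?mob_det_neq0 // e; congr moebius; ring.
have ea : - 1 * 1 - (a + b) * (b - 1) = a ^+ 2.
  apply/eqP; rewrite -subr_eq0; apply/eqP.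
  transitivity (a + b - 1 - (a ^+ 2 + a * b + b ^+ 2)); first by ring.
  by rewrite e subrr.
rewrite !e1 moebius_comp ?ea ?expf_neq0 //.
rewrite -[RHS](@moebius_id _ (- a ^+ 2)) ?oppr_eq0 ?expf_neq0 // -ea.
by congr moebius; ring.
Qed.

Lemma tetrahedral_disconnected : (12 <= #|F|)%N ->
  exists a b, [/\ a != 0, factor 1 0 != factor a b & ~ transitive2 1 0 a b].
Proof.
move=> q12; have [a [b [a0 e]]] := tetrahedral_exists.
have o0 := oner_neq0 F.
exists a, b; split=> //.
  apply/eqP => /(factor_inj_pair qmod3 o0 a0)[] [ea eb]; move: e; rewrite ea eb.
    by rewrite !(mul0r, mulr0, addr0, expr0n, expr1n) subrr => /eqP; rewrite (negPf o0).
  move/eqP; rewrite -subr_eq0 (_ : _ - _ = 2%:R) ?(negPf two_neq0) //; ring.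
have [S [vS cS cl1 cl2]] := tetrahedral_orbit None (mob3 0 ^~ o0) (mob3 b ^~ a0)
  (fun v => tetrahedral_relation v a0 e).
move/(_ S None cl1 cl2 vS) => eS; move: cS; rewrite eS cardsT card_option.
by rewrite ltnNge q12.
Qed.

End Tetrahedral.

(** * Disconnected unions: sublines *)

(** Otherwise X^m - 1 would have more than m roots. *)
Lemma exponent_bound (F : finFieldType) m :
  (0 < m)%N -> (forall x : F, x != 0 -> x ^+ m = 1) -> (#|F| <= m.+1)%N.
Proof.
move=> m0 h; have := @max_unity_roots F m (enum [set~ (0 : F)]) m0.
rewrite enum_uniq -cardE cardsC1 => bd; rewrite -subn1 leq_subLR add1n in bd.
apply: bd => //.
apply/allP => x; rewrite mem_enum !inE => x0; apply/unity_rootP; exact: h.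
Qed.

Section Subline.

Variables (F : finFieldType) (d n : nat).
Hypotheses (qmod3 : #|F| = 2 %[mod 3]) (q2 : #|F| = (2 ^ n)%N).
Hypotheses (dn : (d %| n)%N) (d1 : (1 < d)%N) (ltdn : (d < n)%N).

Lemma pchar2 : 2 \in [pchar F].
Proof. exact: card_finPcharP q2 isT. Qed.

(** The powers x^k with k = (q-1)/(2^d-1) lie in the subfield of order 2^d, and
    not all of them are 0 or 1, since X^k - 1 has fewer than q-1 roots. *)
Lemma subfield_element : exists b : F, [/\ b != 0, b != 1 & b ^+ (2 ^ d) = b].
Proof.
have N4 : (3 <= (2 ^ d).-1)%N by rewrite -ltnS prednK ?expn_gt0 // (@leq_pexp2l 2 2).
have q4 : (0 < #|F|.-1)%N by rewrite -ltnS prednK ?(ltnW (finRing_gt1 F)) // finRing_gt1.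
have /dvdnP[k ek] : ((2 ^ d).-1 %| #|F|.-1)%N.
  by rewrite q2 -(divnK dn) mulnC expnM [X in (_ %| X)%N]predn_exp dvdn_mulr.
have k0 : (0 < k)%N by move: q4; rewrite ek muln_gt0 => /andP[].
have [x x0 xk] : exists2 x : F, x != 0 & x ^+ k != 1.
  apply/exists_inP; apply: contraT; rewrite negb_exists_in => /forall_inP all1.
  have := @exponent_bound F k k0 (fun x x0 => eqP (negbNE (all1 x x0))).
  have -> : #|F| = #|F|.-1.+1 by rewrite prednK // (ltnW (finRing_gt1 F)).
  rewrite ltnS ek leqNgt -[X in (X < _)%N]muln1 ltn_pmul2l //.
  by rewrite (leq_trans _ N4).
exists (x ^+ k); split; rewrite ?expf_neq0 //.
rewrite -exprM -[(2 ^ d)%N]prednK ?expn_gt0 // mulnS exprD -ek.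
suff -> : x ^+ #|F|.-1 = 1 by rewrite mulr1.
apply: (mulfI x0); rewrite -exprS prednK ?(ltnW (finRing_gt1 F)) //.
by rewrite expf_card mulr1.
Qed.

Lemma subline_closed (b : F) : b ^+ (2 ^ d) = b ->
  closed_under 1 b [set v | if v is Some x then x ^+ (2 ^ d) == x else true].
Proof.
move=> eb; have nat2 : [pchar F].-nat (2 ^ d)%N.
  by rewrite pnatX pnatE // pchar2.
have addP x y : (x + y) ^+ (2 ^ d) = x ^+ (2 ^ d) + y ^+ (2 ^ d) :> F.
  exact: exprDn_pchar.
have oppP x : - x = x :> F by apply: oppr_pchar2; apply: pchar2.
case=> [x|] /=; rewrite !inE ?eb // => /eqP ex.
case: ifP => // _.
by rewrite expr1n mul1r oppP !addP exprVn !addP expr1n eb ex.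
Qed.

(** The invariant set is the projective line over the subfield of order 2^d; it
    is proper because X^(2^d) - X has at most 2^d roots. *)
Lemma subline_disconnected : exists b : F,
  factor 1 0 != factor 1 b /\ ~ transitive2 1 0 1 b.
Proof.
have [b [b0 b1 eb]] := subfield_element; have o0 := oner_neq0 F.
exists b; split.
  apply/eqP => /(factor_inj_pair qmod3 o0 o0)[] [_ /eqP]; first by rewrite (negPf b0).
  by rewrite addr0 (negPf b1).
have e0 : 0 ^+ (2 ^ d) = 0 :> F by rewrite expr0n expn_eq0.
move=> tr; have := tr _ None (subline_closed e0) (subline_closed eb).
rewrite inE => /(_ isT)/setP all.
have := @exponent_bound F (2 ^ d).-1.
rewrite !prednK ?expn_gt0 // -ltnS prednK ?expn_gt0 //.
rewrite (@leq_pexp2l 2 1) ?(ltnW d1) // q2 leq_exp2l // leqNgt ltdn => /(_ isT) bd.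
apply/notF/bd => x x0; apply: (mulfI x0); rewrite -exprS prednK ?expn_gt0 // mulr1.
by apply/eqP; have := all (Some x); rewrite !inE.
Qed.

End Subline.

(** * The orders 2, 5 and 11 *)

Section Small.

Variable F : finFieldType.
Hypothesis qmod3 : #|F| = 2 %[mod 3].
Implicit Types (a b c d z : F) (u v w : option F) (S : {set option F}).

Lemma closed_imset (f : option F -> option F) a b a' b' S :
  (forall v, f (mob a b v) = mob a' b' (f v)) ->
  closed_under a b S -> closed_under a' b' (f @: S).
Proof.
by move=> e cl _ /imsetP[v vS ->]; rewrite -e; apply/imset_f/cl.
Qed.

Lemma factor_conj (f : option F -> option F) a b c d a' b' c' d' :
  injective f -> (forall v, f (mob a b v) = mob a' b' (f v)) ->
  (forall v, f (mob c d v) = mob c' d' (f v)) ->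
  a != 0 -> c != 0 -> a' != 0 -> c' != 0 ->
  factor a' b' = factor c' d' -> factor a b = factor c d.
Proof.
move=> inj e1 e2 a0 c0 a'0 c'0 /(factor_inj_pair qmod3 a'0 c'0) e.
have [[-> ->]|[-> ->]] : (c = a /\ d = b) \/ (c = - a /\ d = a + b).
- case: e => -[ec ed]; [left|right]; apply: mob_inj_param; rewrite ?oppr_eq0 // => v;
    apply: inj; rewrite e2 ec ed; first by rewrite e1.
  by rewrite !mob_opp // !e1.
- by [].
- by rewrite factor_opp.
Qed.

(** If S has at most six points then it is covered by at most two orbits of
    [mob a b], so each orbit of [mob c d] in S meets one of them twice. *)
Lemma shared_arc a b c d S v : a != 0 -> c != 0 ->
  closed_under a b S -> closed_under c d S -> v \in S -> (#|S| <= 6)%N ->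
  exists2 u, u \in S & mob c d u \in [set mob a b u; mob a b (mob a b u)].
Proof.
move=> a0 c0 cla clc vS S6; set h := mob c d.
have arc u : h u \in orb a b u -> h u \in [set mob a b u; mob a b (mob a b u)].
  by rewrite /orb -setUA inE in_set1 (negPf (mob_neq qmod3 d u c0)).
have [w1|w1] := boolP (h v \in orb a b v); first by exists v; rewrite ?arc.
have [w2|w2] := boolP (h (h v) \in orb a b v).
  exists (h (h v)); first exact/clc/clc.
  by apply: arc; rewrite [h (h (h v))]mob3 // (orb_eq a0 w2) orb_self.
exists (h v); first exact: clc; apply: arc.
have dis : [disjoint orb a b v & orb a b (h v)].
  apply: contraR w1 => /pred0Pn[x /andP[/= xv xh]].
  by rewrite -(orb_eq a0 xv) (orb_eq a0 xh) orb_self.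
have : orb a b v :|: orb a b (h v) == S.
  rewrite eqEcard subUset !closed_orb ?(clc v) //=.
  by rewrite cardsU disjoint_setI0 // cards0 subn0 !card_orb.
move/eqP/setP/(_ (h (h v))); rewrite inE (negPf w2) /= => ->.
exact/clc/clc.
Qed.

(** The maps [mob 1 0] and [mob z 0] share the arc from infinity to 0. The orbits
    {oo, 0, 1} and {z, 1/(1-z), 1-1/z} of the first map lie in S. If they exhaust
    S, then the orbit {1, h 1, h (h 1)} of h = [mob z 0] is the complement in S of
    its orbit {oo, 0, z}, so that {h 1, h (h 1)} = {1/(1-z), 1-1/z}. One of the
    two matchings gives z^2 = -1, the other one z^4 = 1 together with
    z^3 = (z-1)^2, hence z^2 = -1 again, or z = -1 and 5 = 0. *)
Lemma shared_arc_at_infinity z S : z != 0 -> z != 1 ->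
  closed_under 1 0 S -> closed_under z 0 S -> None \in S ->
  (6 <= #|S|)%N /\ (#|S| = 6 -> (exists i : F, i ^+ 2 = -1) \/ 5%:R = 0 :> F).
Proof.
move=> z0 z1 cl1 clz oS; have o0 := oner_neq0 F.
have zS : Some z \in S by have := clz _ (clz _ oS); rewrite mob2_None // addr0.
have s0 : Some 0 \in S := cl1 _ oS.
have s1 : Some 1 \in S by have := cl1 _ (cl1 _ oS); rewrite mob2_None // addr0.
have o1E : orb (1 : F) 0 None = [set None; Some 0; Some 1].
  by rewrite /orb mob2_None // addr0.
have u1 : mob 1 0 (Some z) = Some (1 - z)^-1.
  by rewrite /= addr0 (negPf z1) expr1n mul1r add0r.
have u2 : mob 1 0 (mob 1 0 (Some z)) = Some (1 - z^-1).
  rewrite -mob_opp // addr0 /= addNr (negPf z0).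
  by rewrite sub0r sqrrN expr1n invrN mul1r.
have w1 : mob z 0 (Some 1) = Some (z ^+ 2 / (z - 1)).
  by rewrite /= addr0 eq_sym (negPf z1) add0r.
have w2 : mob z 0 (mob z 0 (Some 1)) = Some (z - z ^+ 2).
  rewrite -mob_opp // addr0 /= addNr (negPf o0).
  by rewrite sub0r invrN1; congr Some; ring.
have dis : [disjoint orb 1 0 None & orb 1 0 (Some z)].
  have : Some z \notin orb 1 0 None.
    by rewrite o1E !inE !negb_or /= (inj_eq Some_inj) z0 (inj_eq Some_inj).
  apply: contraR => /pred0Pn[x /andP[/= xv xh]].
  by rewrite -(orb_eq o0 xv) (orb_eq o0 xh) orb_self.
have sub : orb 1 0 None :|: orb 1 0 (Some z) \subset S.
  by rewrite subUset !closed_orb.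
have c6 : #|orb 1 0 None :|: orb 1 0 (Some z)| = 6.
  by rewrite cardsU disjoint_setI0 // cards0 subn0 !card_orb.
split=> [|S6]; first by have := subset_leq_card sub; rewrite c6.
have eS : S = [set None; Some 0; Some 1] :|:
    [set Some z; Some (1 - z)^-1; Some (1 - z^-1)].
  by apply/esym/eqP; rewrite -o1E -u1 -u2 eqEcard sub c6 S6.
have zz1 : z - 1 != 0 by rewrite subr_eq0.
have z1z : 1 - z != 0 by rewrite subr_eq0 eq_sym.
have nform : z ^+ 2 - z + 1 != 0.
  apply: contraNneq o0 => e; rewrite -oppr_eq0; apply/eqP/(@anisotropic F qmod3 z).
  by rewrite -[RHS]e; ring.
have in1 := clz _ s1; have in2 := clz _ in1.
move: in1; rewrite w1 eS !inE !(inj_eq Some_inj) /=.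
have e0 x y : x = y -> x - y = 0 :> F by move=> ->; rewrite subrr.
have done_i : z ^+ 2 + 1 = 0 -> (exists i : F, i ^+ 2 = -1) \/ 5%:R = 0 :> F.
  by move=> e; left; exists z; apply/eqP; rewrite -subr_eq0 opprK e.
have nz x : x != 0 -> x = 0 -> False by move=> /eqP.
case/orP => [/orP[]|/orP[/orP[]|]] /eqP/e0 e.
(* h 1 is one of 0, 1, z, 1/(1-z), 1-1/z; only the last two can happen. *)
- case/nz: (mulf_neq0 (expf_neq0 2 z0) (invr_neq0 zz1)); by rewrite -[RHS]e subr0.
- case/nz: nform; rewrite -[RHS](mulr0 (z - 1)) -e; field; exact: zz1.
- case/nz: z0; rewrite -[RHS](mulr0 (z - 1)) -e; field; exact: zz1.
- apply: done_i; rewrite -[RHS](mulr0 (z - 1)) -e; field; exact/andP.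
have {}e : z ^+ 3 = (z - 1) ^+ 2.
  apply/eqP; rewrite -subr_eq0 -(mulr0 (z * (z - 1))) -e; apply/eqP.
  by field; apply/andP.
move: in2; rewrite w2 eS !inE !(inj_eq Some_inj) /=.
case/orP => [/orP[]|/orP[/orP[]|]] /eqP/e0 e'.
(* The same five cases for h (h 1), given that h 1 = 1-1/z. *)
- case/nz: (mulf_neq0 z0 z1z); rewrite -[RHS]e'; ring.
- case/nz: nform; rewrite -[RHS]oppr0 -e'; ring.
- case/nz: (expf_neq0 2 z0); rewrite -[RHS]oppr0 -e'; ring.
- have {}e' : (z - 1) * (z + 1) * (z ^+ 2 + 1) = 0.
    transitivity (z * (z ^+ 3 - (z - 1) ^+ 2) + (z * (1 - z) ^+ 2 - 1)); first by ring.
    by rewrite e subrr mulr0 add0r -(mulr0 (1 - z)) -e'; field.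
  move/eqP: e'; rewrite !mulf_eq0 (negPf zz1) /= => /orP[] /eqP; last exact: done_i.
  move=> e'; right; rewrite -[RHS](subrr ((z - 1) ^+ 2)) -{2}e.
  have -> : z = -1 by apply/eqP; rewrite -subr_eq0 opprK e'.
  by ring.
- apply: done_i; apply: (mulfI zz1); rewrite mulr0 -(mulr0 (- z)) -e'; field; exact: z0.
Qed.

(** The maps share the arc that starts at u; placing u at infinity and rescaling
    gives the normal form above. *)
Lemma shared_arc_card a b c d S u : a != 0 -> c != 0 -> ~~ [&& c == a & d == b] ->
  closed_under a b S -> closed_under c d S -> u \in S -> mob c d u = mob a b u ->
  (6 <= #|S|)%N /\ (#|S| = 6 -> (exists i : F, i ^+ 2 = -1) \/ 5%:R = 0 :> F).
Proof.
move=> a0 c0.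
have atoo a1 c1 b1 S1 : a1 != 0 -> c1 != 0 -> c1 != a1 -> None \in S1 ->
    closed_under a1 b1 S1 -> closed_under c1 b1 S1 ->
    (6 <= #|S1|)%N /\ (#|S1| = 6 -> (exists i : F, i ^+ 2 = -1) \/ 5%:R = 0 :> F).
  move=> a10 c10 ne oS cl1 cl2; have bij := rescale_bij b1 a10.
  rewrite -(card_imset S1 (bij_inj bij)); apply: (@shared_arc_at_infinity (c1 / a1)).
  - by rewrite mulf_neq0 ?invr_eq0.
  - by apply: contraNneq ne => e; rewrite -[c1](divfK a10) e mul1r.
  - apply: closed_imset cl1 => v; rewrite rescale_mob //.
    by rewrite divff // subrr mul0r.
  - apply: closed_imset cl2 => v; rewrite rescale_mob //.
    by rewrite subrr mul0r.
  - by apply/imsetP; exists None; rewrite //= /proj eqxx.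
case: u => [P|] ne cl1 cl2 uS eu; last first.
  case: eu => eb; rewrite eb in ne cl2; apply: (atoo a c b) => //.
  by move: ne; rewrite eqxx andbT.
have [a' [b' [a'0 ea]]] := inversion_conj qmod3 P b a0.
have [c' [d' [c'0 ec]]] := inversion_conj qmod3 P d c0.
have inj := inv_inj (inversionK P).
have [eb] : Some b' = Some d'.
  have := ea (Some P); rewrite -eu ec inversion_self /= => -[->]; reflexivity.
rewrite -(card_imset S inj); apply: (atoo a' c' b') => //.
- apply: contraNneq ne => e; suff [-> ->] : c = a /\ d = b by rewrite !eqxx.
  by apply: mob_inj_param => // v; apply: inj; rewrite ea ec e eb.
- by apply/imsetP; exists (Some P); rewrite // inversion_self.
- exact: closed_imset ea cl1.
- by rewrite eb; exact: closed_imset ec cl2.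
Qed.

(** Replacing [mob a b] by its inverse, if need be, makes the two maps follow the
    shared arc in the same direction. *)
Lemma closed_card a b c d S v : a != 0 -> c != 0 -> factor a b != factor c d ->
  closed_under a b S -> closed_under c d S -> v \in S ->
  (6 <= #|S|)%N /\ (#|S| = 6 -> (exists i : F, i ^+ 2 = -1) \/ 5%:R = 0 :> F).
Proof.
move=> a0 c0 ne cl1 cl2 vS; have [S7|S6] := ltnP 6 #|S|.
  by split=> [|e]; [exact: ltnW|rewrite e in S7].
have [u uS] := shared_arc a0 c0 cl1 cl2 vS S6.
rewrite !inE => /orP[]/eqP eu.
  apply: (shared_arc_card a0 c0 _ cl1 cl2 uS eu).
  by apply: contraNN ne => /andP[/eqP-> /eqP->].
have a0' : - a != 0 by rewrite oppr_eq0.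
apply: (@shared_arc_card (- a) (a + b) c d S u) => //.
- by apply: contraNN ne => /andP[/eqP-> /eqP->]; rewrite factor_opp.
- by move=> w wS; rewrite mob_opp //; apply/cl1/cl1.
- by rewrite mob_opp.
Qed.

(** An invariant set and its complement would both have at least six of the
    q + 1 points, so exactly six, and q = 11. But modulo 11 neither is -1 a
    square nor does 5 vanish. *)
Lemma small_transitive a b c d : #|F| \in [:: 2; 5; 11] ->
  a != 0 -> c != 0 -> factor a b != factor c d -> transitive2 a b c d.
Proof.
move=> hq a0 c0 ne S v cl1 cl2 vS; apply/eqP/negPn/negP => nT.
have [w wS] : exists w, w \in ~: S.
  by apply/set0Pn; rewrite -setCT (inj_eq (@setC_inj _)).
have [S6 S6eq] := closed_card a0 c0 ne cl1 cl2 vS.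
have [C6 _] := closed_card a0 c0 ne (closed_compl a0 cl1) (closed_compl c0 cl2) wS.
have := cardsC S; rewrite card_option => eq.
have q11 : #|F| = 11.
  move: hq eq; rewrite !inE => /or3P[] /eqP -> // eq.
    by have := leq_add S6 C6; rewrite eq.
  by have := leq_add S6 C6; rewrite eq.
have /S6eq[[i i2]|/eqP] : #|S| = 6.
  apply/eqP; rewrite eqn_leq S6 andbT -(leq_add2r #|~: S|) eq q11.
  by rewrite -(leq_add2l 6) in C6.
- have n2 : 2%:R != 0 :> F by apply: prime_natr_neq0; rewrite ?q11.
  have := expf_card i; rewrite q11 (_ : i ^+ 11 = i * (i ^+ 2) ^+ 5); last by ring.
  rewrite i2 => /eqP; rewrite -subr_eq0.
  rewrite (_ : _ - _ = - 2%:R * i); last by ring.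
  rewrite mulf_eq0 oppr_eq0 (negPf n2) /= => /eqP i0.
  by move/eqP: i2; rewrite i0 expr0n eq_sym oppr_eq0 oner_eq0.
- by rewrite (negPf (prime_natr_neq0 _ _)) ?q11.
Qed.

End Small.

(** * Groups of Moebius maps in characteristic 2 *)

Section MoebiusGroup.

Variable F : finFieldType.
Implicit Types (a b c d l m n p x y : F) (u v w : option F).

(** PGL(2,q) as a set of permutations of the line; the matrix is a quadruple so
    that the quantifier over it ranges over a finite type. *)
Definition pgl : {set {perm option F}} :=
  [set g : {perm option F} | [exists M : (F * F) * (F * F),
    (M.1.1 * M.2.2 - M.1.2 * M.2.1 != 0) &&
    [forall v, g v == moebius M.1.1 M.1.2 M.2.1 M.2.2 v]]].

Lemma pglP (g : {perm option F}) :
  reflect (exists a b c d, a * d - b * c != 0 /\ forall v, g v = moebius a b c d v)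
          (g \in pgl).
Proof.
rewrite inE; apply: (iffP existsP).
  case=> -[[a b] [c d]] /andP[D /forallP h].
  by exists a, b, c, d; split=> // v; apply/eqP.
case=> a [b [c [d [D h]]]]; exists ((a, b), (c, d)); rewrite D /=.
by apply/forallP => v; rewrite h.
Qed.

Lemma pgl_group_set : group_set pgl.
Proof.
apply/group_setP; split=> [|g h].
  apply/pglP; exists 1, 0, 0, 1; rewrite mulr1 mulr0 subr0 oner_neq0; split=> // v.
  by rewrite perm1 moebius_id ?oner_neq0.
move=> /pglP[a [b [c [d [D e]]]]] /pglP[a' [b' [c' [d' [D' e']]]]].
apply/pglP; do 4!eexists; split; last first.
  by move=> v; rewrite permM e' e moebius_comp.
rewrite (_ : _ - _ = (a' * d' - b' * c') * (a * d - b * c)) ?mulf_neq0 //.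
by ring.
Qed.

Canonical pgl_group := Group pgl_group_set.

Lemma pgl_affine (g : {perm option F}) : g \in pgl -> g None = None ->
  exists m n, m != 0 /\ forall x, g (Some x) = Some (m * x + n).
Proof.
case/pglP=> a [b [c [d [D e]]]]; rewrite e /= /proj; case: eqP => // c0 _.
move: D; rewrite c0 mulr0 subr0 mulf_eq0 negb_or => /andP[a0 d0].
exists (a / d), (b / d); split=> [|x]; first by rewrite mulf_neq0 ?invr_eq0.
by rewrite e /= /proj c0 mul0r add0r (negPf d0) mulrDl mulrAC.
Qed.

Lemma translation_inj l : injective (omap (fun x => x + l)).
Proof. by move=> [x|] [y|] //= [/addIr ->]. Qed.

Definition translation l : {perm option F} := perm (@translation_inj l).

Lemma translationE l v : translation l v = omap (fun x => x + l) v.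
Proof. by rewrite permE. Qed.

Lemma translation_pgl l : translation l \in pgl.
Proof.
apply/pglP; exists 1, l, 0, 1; split=> [|[x|]].
- by rewrite mulr0 subr0 mulr1 oner_neq0.
- by rewrite translationE /= /proj mul0r add0r oner_eq0 mul1r divr1.
- by rewrite translationE /= /proj eqxx.
Qed.

Lemma translationD l m : (translation l * translation m)%g = translation (l + m).
Proof. by apply/permP => -[x|]; rewrite permM !translationE //= addrA. Qed.

Lemma translation_is_inj : injective translation.
Proof.
move=> l m /permP/(_ (Some 0)); rewrite !translationE /= !add0r => -[]//.
Qed.

Lemma conj_translation (g : {perm option F}) m n l : g None = None ->
  (forall x, g (Some x) = Some (m * x + n)) ->
  (translation l ^ g)%g = translation (m * l).
Proof.
move=> g0 gE; apply/permP => w; rewrite -(permKV g w) permJ !translationE.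
case: ((g^-1)%g w) => [x|] /=; rewrite ?g0 // !gE /=.
by congr Some; ring.
Qed.

Lemma mob_pgl a b (g : {perm option F}) : a != 0 -> g =1 mob a b -> g \in pgl.
Proof.
move=> a0 e; apply/pglP; do 4!eexists; split; last by move=> v; rewrite e mobE.
exact: mob_det_neq0.
Qed.

Hypothesis ch2 : 2 \in [pchar F].

(** Throughout, G is a group of Moebius maps that contains a nontrivial
    translation, normalised to x + 1, and that moves infinity. *)
Variable G : {group {perm option F}}.
Hypotheses (GP : G \subset pgl) (G1 : translation 1 \in G).
Variable g0 : {perm option F}.
Hypotheses (Gg0 : g0 \in G) (g0oo : g0 None != None).

Definition shifts := [set l | translation l \in G].

Let shifts' := shifts :\ 0.
Let moved := orbit 'P G None :\ None.

Lemma shiftsD l m : l \in shifts -> m \in shifts -> l + m \in shifts.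
Proof. by rewrite !inE -translationD; apply: groupM. Qed.

Lemma shifts1 : 1 \in shifts'.
Proof. by rewrite !inE oner_neq0. Qed.

Let fix2 p := [set g in G | (g None == None) && (g (Some p) == Some p)].
Let swaps w := [set u in G | (u * u == 1)%g && (u None == w)].

(* The multiplier g (p + 1) - g p of an affine map g that fixes p. *)
Let mult p (g : {perm option F}) := odflt 0 (g (Some (p + 1))) - p.

(** The multiplier is a shift because conjugation by g turns x + 1 into
    x + [mult p g]. *)
Lemma fix2_mult p g : g \in fix2 p ->
  [/\ mult p g \in shifts', g None = None &
      forall x, g (Some x) = Some (mult p g * (x - p) + p)].
Proof.
rewrite inE => /and3P[gG /eqP g1 /eqP gp].
have [m [n [m0 gE]]] := pgl_affine (subsetP GP _ gG) g1.
have [e] : Some (m * p + n) = Some p by rewrite -gE.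
have -> : mult p g = m by rewrite /mult gE /= -[X in _ - X]e; ring.
split=> // [|x]; last first.
  by rewrite gE (_ : n = p - m * p); [congr Some; ring | rewrite -{1}e; ring].
rewrite !inE m0 -[m]mulr1 -(conj_translation 1 g1 gE).
by rewrite groupJ.
Qed.

Lemma mult_inj p : {in fix2 p &, injective (mult p)}.
Proof.
move=> g h /fix2_mult[_ g1 gE] /fix2_mult[_ h1 hE] e.
by apply/permP => -[x|]; rewrite ?g1 // gE hE e.
Qed.

Lemma mult_sub p : mult p @: fix2 p \subset shifts'.
Proof. by apply/subsetP => _ /imsetP[g /fix2_mult[mS _ _] ->]. Qed.

Lemma card_fix2_le p : (#|fix2 p| <= #|shifts'|)%N.
Proof.
by rewrite -(card_in_imset (@mult_inj p)) subset_leq_card ?mult_sub.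
Qed.

Lemma card_swaps_le p : (#|swaps (Some p)| <= #|fix2 p|)%N.
Proof.
have [->|/set0Pn[u]] := eqVneq (swaps (Some p)) set0; first by rewrite cards0.
rewrite inE => /and3P[uG /eqP uu /eqP up].
have swap (z : {perm option F}) : (z * z = 1)%g -> z None = Some p -> z (Some p) = None.
  by move=> zz <-; rewrite -permM zz perm1.
rewrite -(card_imset _ (mulgI u)); apply/subset_leq_card/subsetP => _ /imsetP[w + ->].
rewrite !inE => /and3P[wG /eqP ww /eqP wp].
by rewrite groupM //= !permM up (swap u) // (swap w) // wp !eqxx.
Qed.

(** Each w in [moved] is the only fixed point of the conjugates of the nontrivial
    translations in G by a map of G that takes infinity to w, so that at least
    |moved| * |shifts'| involutions of G move infinity. On the other hand the
    involutions taking infinity to p lie in one coset of the stabiliser of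
    infinity and p, and a map of this stabiliser is determined by its
    multiplier, hence there are at most |shifts'| of them. Summing over p shows
    that all these bounds are equalities. *)
Lemma card_swaps p : Some p \in moved -> #|swaps (Some p)| = #|shifts'|.
Proof.
(* The default value is never used on moved. *)
pose h w := odflt 1%g [pick g in G | g None == w].
have hP w : w \in moved -> h w \in G /\ h w None = w.
  rewrite 2!inE => /andP[_ /orbitP[g gG gw]]; rewrite /h; case: pickP => [k|].
    by case/andP=> kG /eqP.
  by move/(_ g); rewrite gG -gw /= apermE eqxx.
pose inv (t : option F * F) := (translation t.2 ^ h t.1)%g.
pose U := [set u in G | (u * u == 1)%g && (u None != None)].
have fixP w l v : w \in moved -> l \in shifts' ->
    (inv (w, l) v == v) = (v == w).
  case/hP => hG hw; rewrite !inE => /andP[l0 _]; rewrite /inv /=.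
  rewrite -{1 2}(permKV (h w) v) permJ (inj_eq perm_inj) -[in RHS]hw.
  rewrite -[in RHS](permKV (h w) v) (inj_eq perm_inj) translationE.
  case: ((h w)^-1%g v) => [x|//] /=; rewrite (inj_eq Some_inj).
  by rewrite -subr_eq0 addrC addKr (negPf l0).
have invU t : t \in setX moved shifts' -> inv t \in U.
  case: t => w l; rewrite in_setX => /andP[/= wM lS]; have [hG hw] := hP w wM.
  have w0 : None != w by move: wM; rewrite 2!inE eq_sym => /andP[].
  have lG : translation l \in G by move: lS; rewrite !inE => /andP[].
  rewrite inE fixP // w0 andbT /inv /= groupJ //= -conjMg translationD.
  rewrite -mulr2n -[l]mul1r -mulrnAl pcharf0 // mul0r.
  suff -> : translation 0 = 1%g by rewrite conj1g eqxx.
  by apply/permP => -[x|]; rewrite perm1 translationE //= addr0.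
have inv_inj : {in setX moved shifts' &, injective inv}.
  move=> [w l] [w' l'] /=; rewrite !in_setX => /andP[/= wM lS] /andP[/= w'M l'S] e.
  have ew : w = w' by apply/eqP; rewrite -(fixP w' l') // -e fixP.
  by move: e; rewrite ew => /conjg_inj/translation_is_inj /= ->.
have Ule : (#|moved| * #|shifts'| <= #|U|)%N.
  rewrite -cardsX -(card_in_imset inv_inj); apply/subset_leq_card.
  by apply/subsetP => _ /imsetP[t tM ->]; apply: invU.
have Usum : #|U| = (\sum_(w in moved) #|swaps w|)%N.
  rewrite -sum1_card (partition_big (fun u : {perm option F} => u None) [in moved]) /=.
    apply: eq_bigr => w wM; rewrite -sum1_card; apply: eq_bigl => u.
    have w0 : w != None by move: wM; rewrite 2!inE => /andP[].
    by rewrite !inE; case: (u None =P w) => [->|_]; rewrite ?w0 ?andbT ?andbF.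
  move=> u; rewrite !inE => /and3P[uG _ ->] /=; exact: (mem_orbit 'P None uG).
have le w : w \in moved -> (#|swaps w| <= #|shifts'| ?= iff (#|swaps w| == #|shifts'|))%N.
  case: w => [x _|]; last by rewrite !inE.
  by apply/leqif_eq/(leq_trans (card_swaps_le x))/card_fix2_le.
have /geq_leqif := leqif_sum le; rewrite sum_nat_const -Usum Ule => /esym.
by move/forall_inP=> all pM; apply/eqP/all.
Qed.

Lemma mult_surj p l : Some p \in moved -> l \in shifts' ->
  exists2 g, g \in fix2 p & mult p g = l.
Proof.
move=> pM lS; have : mult p @: fix2 p == shifts'.
  rewrite eqEcard mult_sub (card_in_imset (@mult_inj p)) -(card_swaps pM).
  exact: card_swaps_le.
by move/eqP/setP/(_ l); rewrite lS => /imsetP[g gp ->]; exists g.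
Qed.

Lemma moved_ex : exists p, Some p \in moved.
Proof.
case e: (g0 None) g0oo => [p|//] _; exists p.
by rewrite !inE /= -e; apply: (mem_orbit 'P None Gg0).
Qed.

(** Conjugating x + m by a map with multiplier l gives x + lm. *)
Lemma shiftsM l m : l \in shifts -> m \in shifts -> l * m \in shifts.
Proof.
have s0 : 0 \in shifts.
  rewrite inE (_ : translation 0 = 1%g) ?group1 //.
  by apply/permP => -[x|]; rewrite perm1 translationE //= addr0.
have [->|l0] := eqVneq l 0; first by rewrite mul0r.
move=> lS mS; have [p pM] := moved_ex.
have [g gp <-] : exists2 g, g \in fix2 p & mult p g = l.
  by apply: mult_surj => //; rewrite in_setD1 l0.
have [_ g1 gE] := fix2_mult gp; rewrite inE.
rewrite -(@conj_translation g (mult p g) (p - mult p g * p)) //.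
  by rewrite groupJ //; [rewrite inE in mS|move: gp; rewrite inE => /andP[]].
by move=> x; rewrite gE; congr Some; ring.
Qed.

(** An involution of G exchanging infinity and p, composed with g, fixes
    infinity, and a homothety in the stabiliser of infinity and p turns it into
    a translation. *)
Lemma shifts_pole (g : {perm option F}) p y :
  g \in G -> g None = Some p -> g (Some y) = None -> p - y \in shifts.
Proof.
move=> gG gp gy.
have pM : Some p \in moved by rewrite !inE /= -gp; apply: (mem_orbit 'P None gG).
have /set0Pn[u] : swaps (Some p) != set0.
  by rewrite -card_gt0 (card_swaps pM) card_gt0; apply/set0Pn; exists 1; apply: shifts1.
rewrite inE => /and3P[uG /eqP uu /eqP up].
have pu : u (Some p) = None by rewrite -up -permM uu perm1.
have k1 : (g * u)%g None = None by rewrite permM gp.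
have kG : (g * u)%g \in G by rewrite groupM.
have [m [n [m0 kE]]] := pgl_affine (subsetP GP _ kG) k1.
have [c cp cm] : exists2 c, c \in fix2 p & mult p c = m.
  apply: mult_surj => //; rewrite !inE m0 -[m]mulr1 -(conj_translation 1 k1 kE).
  by rewrite groupJ.
have [_ c1 cE] := fix2_mult cp; rewrite cm in cE.
have cG : c \in G by move: cp; rewrite inE => /andP[].
have yE : Some (m * y + n) = Some p by rewrite -kE permM gy up.
rewrite inE (_ : translation _ = (g * u * c^-1)%g) ?groupM ?groupV //.
apply: (mulIg c); rewrite mulgKV; apply/permP => -[x|]; last first.
  by rewrite k1 permM translationE.
rewrite kE permM translationE /= cE; congr Some; case: yE => <-.
by ring.
Qed.

End MoebiusGroup.

(** * Fields of order 2^p with p prime *)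

Section SubringPrimeDegree.

Variables (F : finFieldType) (p : nat).
Hypotheses (pp : prime p) (q2 : #|F| = (2 ^ p)%N).
Variables (L : {set F}) (b : F).
Hypotheses (L1 : 1 \in L) (LD : {in L &, forall x y, x + y \in L}).
Hypotheses (LM : {in L &, forall x y, x * y \in L}).
Hypotheses (Lb : b \in L) (b0 : b != 0) (b1 : b != 1).

Let ch2 : 2 \in [pchar F] := card_finPcharP q2 isT.

Let L0 : 0 \in L.
Proof. by rewrite -(addrr_pchar2 ch2 1) LD. Qed.

Lemma subring_group_set : group_set L.
Proof. by apply/group_setP; split=> // x y; apply: LD. Qed.

(** In characteristic 2 the additive group of L is elementary abelian. *)
Lemma card_subring : exists m, #|L| = (2 ^ m)%N.
Proof.
pose A := Group subring_group_set.
have A2 : (exponent A %| 2)%N.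
  by apply/exponentP => x _; apply: (addrr_pchar2 ch2 x).
have : (2.-group A)%g by rewrite -pnat_exponent (pnat_dvd A2) // pnat_id.
by case/p_natP => m; exists m.
Qed.

(** Multiplication by b permutes the nonzero elements of L, and so preserves
    their product. *)
Lemma subring_pow : b ^+ #|L| = b.
Proof.
have L0' : 0 \in L := L0.
rewrite (cardsD1 0) L0' add1n exprS.
suff -> : b ^+ #|L :\ 0| = 1 by rewrite mulr1.
have P0 : \prod_(x in L :\ 0) x != 0.
  by apply/prodf_neq0 => x; rewrite !inE => /andP[].
apply: (mulIf P0); rewrite mul1r -prodr_const -big_split /=.
have e : [set b * x | x in L :\ 0] = L :\ 0.
  apply/eqP; rewrite eqEcard (card_imset _ (mulfI b0)) leqnn andbT.
  apply/subsetP => _ /imsetP[x + ->]; rewrite !inE => /andP[x0 xL].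
  by rewrite mulf_neq0 // LM.
rewrite -[RHS](congr1 (fun A : {set F} => \prod_(x in A) x) e).
by rewrite big_imset //= => x y _ _; apply: mulfI.
Qed.

(** The element b is fixed by the powers m and p of the Frobenius map, where
    |L| = 2^m. If p did not divide m, it would be fixed by the Frobenius map
    itself, that is, b^2 = b. *)
Lemma subring_full : L = setT.
Proof.
have [m em] := card_subring.
have frob k i : b ^+ (2 ^ k) = b -> b ^+ (2 ^ (i * k)) = b.
  by move=> e; elim: i => [|i IH]; rewrite ?expr1 // mulSn expnD exprM e.
have bm : b ^+ (2 ^ m) = b by rewrite -em subring_pow.
have bp : b ^+ (2 ^ p) = b by rewrite -q2 expf_card.
have pm : (p %| m)%N.
  apply: contraR b1; rewrite -prime_coprime // => /(coprimeP _ (prime_gt0 pp))[[i j] /= eij].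
  have e : (i * p = (j * m).+1)%N.
    by rewrite -add1n -eij subnK // ltnW // -subn_gt0 eij.
  have := frob _ i bp; rewrite e expnSr exprM (frob _ j bm) expr2.
  by rewrite -{3}[b]mulr1 => /(mulfI b0) ->.
have m0 : (0 < m)%N.
  rewrite lt0n; apply: contraTneq (L0) => m0; move: em; rewrite m0 => /eqP/cards1P[x eL].
  by move: L1; rewrite eL !inE => /eqP <-; rewrite eq_sym oner_eq0.
apply/eqP; rewrite eqEcard subsetT cardsT q2 em leq_exp2l //.
exact: dvdn_leq.
Qed.

End SubringPrimeDegree.

(** * Transitivity over fields of order 2^p *)

Section CharTwo.

Variables (F : finFieldType) (p : nat).
Hypotheses (pp : prime p) (q2 : #|F| = (2 ^ p)%N).
Hypothesis qmod3 : #|F| = 2 %[mod 3].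
Implicit Types (a b c d l x y P : F) (u v w : option F) (S : {set option F}).

Let ch2 : 2 \in [pchar F] := card_finPcharP q2 isT.

Lemma opp2 x : - x = x. Proof. exact: oppr_pchar2. Qed.

(** The translation x + 1 inverts each of the maps [mob 1 b]. *)
Lemma translation_mob b v :
  translation 1 (mob 1 b v) = mob 1 b (mob 1 b (translation 1 v)).
Proof.
rewrite -mob_opp ?oner_neq0 // opp2 !translationE.
case: v => [x|] /=; last by rewrite addrC.
have -> : (x + 1 == 1 + (1 + b)) = (x == 1 + b).
  by rewrite [1 + (1 + b)]addrC (inj_eq (addIr 1)).
case: eqP => //= _; congr Some.
by rewrite (_ : 1 + (1 + b) - (x + 1) = 1 + b - x); ring.
Qed.

(** Let S be invariant under both maps and contain infinity. The part S' of S that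
    x + 1 maps into S is then invariant under the group G generated by the two
    maps and x + 1. The shifts of G form a subring, which contains b by
    [shifts_pole], so that G contains every translation and S' is everything. *)
Lemma char2_normal_form b : b != 0 -> b != 1 -> transitive2 1 0 1 b.
Proof.
move=> b0 b1; have o0 := oner_neq0 F.
have atoo S : closed_under 1 0 S -> closed_under 1 b S -> None \in S -> S = setT.
  move=> cl0 clb oS; pose t := translation (1 : F).
  pose A : {perm option F} := perm (mob_inj (b := 0) o0).
  pose B : {perm option F} := perm (mob_inj (b := b) o0).
  pose S' := [set v in S | t v \in S].
  have cl' c : closed_under 1 c S -> closed_under 1 c S'.
    move=> cl v; rewrite !inE => /andP[vS tS]; rewrite cl //= translation_mob.
    exact/cl/cl.
  have actP (g : {perm option F}) :
      (forall v, v \in S' -> g v \in S') -> g \in 'N(S' | 'P)%g.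
    by move=> h; rewrite /astabs !inE /=; apply/subsetP => v /h; rewrite [in X in _ -> X]inE.
  pose gens := [set t; A; B].
  have [tG AG BG] : [/\ t \in <<gens>>, A \in <<gens>> & B \in <<gens>>]%g.
    by split; apply: mem_gen; rewrite !inE eqxx ?orbT.
  have sub (K : {group {perm option F}}) :
      t \in K -> A \in K -> B \in K -> <<gens>>%g \subset K.
    move=> tK AK BK; rewrite gen_subG; apply/subsetP => g.
    by rewrite !inE -orbA => /or3P[]/eqP->.
  have GP : <<gens>>%g \subset pgl F.
    apply: (sub (pgl_group F)); first exact: translation_pgl.
    - by apply: (mob_pgl o0) => v; rewrite permE.
    - by apply: (mob_pgl o0) => v; rewrite permE.
  have actS' : <<gens>>%g \subset 'N(S' | 'P)%g.
    apply: sub; apply: actP => v; [|rewrite permE; exact: cl'..].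
    rewrite !inE => /andP[vS ->] /=; suff -> : t (t v) = v by [].
    by rewrite !translationE; case: v {vS} => //= x; rewrite -addrA addrr_pchar2 // addr0.
  have oS' : None \in S' by rewrite inE oS translationE.
  have BoO : B None != None by rewrite permE.
  pose g := (B * t * A)%g.
  have gG : g \in <<gens>>%g by rewrite !groupM.
  have gp : g None = Some b^-1.
    rewrite !permM !permE /= addr0 -subr_eq0 addrK (negPf b0).
    rewrite (_ : 1 - (b + 1) = b); first by rewrite add0r expr1n div1r.
    by rewrite -[RHS]opp2; ring.
  have gy : g (Some (b + b^-1 + 1)) = None.
    have yb : b + b^-1 + 1 == 1 + b = false.
      rewrite -subr_eq0 (_ : _ - _ = b^-1); last by ring.
      by rewrite invr_eq0 (negPf b0).
    have By : B (Some (b + b^-1 + 1)) = Some 0.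
      rewrite permE /= yb (_ : 1 + b - (b + b^-1 + 1) = - b^-1); last by ring.
      by rewrite invrN invrK expr1n mul1r subrr.
    by rewrite !permM By translationE permE /= add0r addr0 eqxx.
  have bL : b \in shifts [group of <<gens>>%g].
    have s1 : 1 \in shifts [group of <<gens>>%g] by rewrite inE.
    rewrite -[b](addrK 1) opp2 shiftsD //.
    have := shifts_pole ch2 GP tG gG gp gy.
    by rewrite (_ : _ - _ = - (b + 1)); [rewrite opp2 | ring].
  have full := subring_full pp q2 _ (shiftsD (G := [group of <<gens>>%g]))
    (shiftsM ch2 GP tG BG BoO) bL b0 b1.
  have trG x : translation x \in <<gens>>%g.
    by have := full _; rewrite ?inE // => /(_ tG)/setP/(_ x); rewrite !inE.
  apply/setP => v; rewrite inE; suff : v \in S' by rewrite inE => /andP[].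
  have sub' : orbit 'P <<gens>>%g None \subset S' by rewrite acts_sub_orbit.
  apply: (subsetP sub'); case: v => [x|]; last exact: orbit_refl.
  apply/orbitP; exists (B * translation (x - b))%g; first by rewrite groupM.
  by rewrite /= apermE permM !permE /= subrKC.
move=> S v cl0 clb vS; have [oS|oS] := boolP (None \in S); first exact: atoo.
have := atoo (~: S) (closed_compl o0 cl0) (closed_compl o0 clb).
by rewrite inE => /(_ oS)/setP/(_ v); rewrite !inE vS.
Qed.

Lemma transitive2_conj (f : option F -> option F) a b c d a' b' c' d' :
  bijective f -> (forall v, f (mob a b v) = mob a' b' (f v)) ->
  (forall v, f (mob c d v) = mob c' d' (f v)) ->
  transitive2 a' b' c' d' -> transitive2 a b c d.
Proof.
move=> bij e1 e2 tr S v cl1 cl2 vS.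
have := tr _ (f v) (closed_imset e1 cl1) (closed_imset e2 cl2) (imset_f f vS).
move/setP=> e; apply/setP => w; have := e (f w).
by rewrite (mem_imset _ _ (bij_inj bij)) !inE.
Qed.

Lemma char2_same a b d : a != 0 -> factor a b != factor a d -> transitive2 a b a d.
Proof.
move=> a0 ne; apply: (transitive2_conj (rescale_bij b a0)).
- by move=> v; apply: rescale_mob.
- by move=> v; apply: rescale_mob.
rewrite divff // subrr mul0r; apply: char2_normal_form.
- by apply: contraNneq ne => /eqP; rewrite mulf_eq0 invr_eq0 (negPf a0) orbF subr_eq0 => /eqP->.
- apply: contraNneq ne => e; have -> : d = a + b.
    by rewrite -[d](subrK b) -[d - b](divfK a0) e mul1r.
  by rewrite -factor_opp // opp2.
Qed.

Lemma sqrt_exists x : exists y, y ^+ 2 = x.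
Proof.
exists (x ^+ (2 ^ p.-1)); rewrite -exprM -expnSr prednK ?prime_gt0 //.
by rewrite -q2 expf_card.
Qed.

(** The maps [mob a b] and [mob c d] are inverted by a common involution, and P
    is its fixed point: the place where the quadratic forms attached to the two
    maps, divided by their mixed coefficients, agree. *)
Lemma char2_transitive a b c d : a != 0 -> c != 0 -> factor a b != factor c d ->
  transitive2 a b c d.
Proof.
move=> a0 c0 ne; have [eac|nac] := eqVneq a c.
  by rewrite -eac; apply: char2_same; rewrite // eac -{1}eac.
have ac0 : a + c != 0 by rewrite addrC -[a]opp2 subr_eq0 eq_sym.
have [P eP] := sqrt_exists
  ((c * (b ^+ 2 + a * b + a ^+ 2) + a * (d ^+ 2 + c * d + c ^+ 2)) / (a + c)).
have qE x y : qform x y P = P ^+ 2 + x * P + (y ^+ 2 + x * y + x ^+ 2).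
  by rewrite /qform !opp2 sqrrD mulr2n addrr_pchar2 // addr0; ring.
have eQ : c * qform a b P = a * qform c d P.
  apply/eqP; rewrite -subr_eq0 opp2 !qE; apply/eqP.
  transitivity ((a + c) * P ^+ 2 + (a * c * P) *+ 2 +
    (c * (b ^+ 2 + a * b + a ^+ 2) + a * (d ^+ 2 + c * d + c ^+ 2))).
    by ring.
  by rewrite mulr2n addrr_pchar2 // addr0 eP mulrC divfK // addrr_pchar2.
have inj := inv_inj (inversionK P).
have Q0 := qform_neq0 qmod3 b P a0; have Q0' := qform_neq0 qmod3 d P c0.
have ea : - a / qform a b P = - c / qform c d P.
  by apply/eqP; rewrite !mulNr eqr_opp eqr_div // -eQ mulrC.
have e1 v := inversion_mob v a0 Q0; have e2 v := inversion_mob v c0 Q0'.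
rewrite -ea in e2; apply: (transitive2_conj (inv_bij (inversionK P)) e1 e2).
have a'0 : - a / qform a b P != 0 by rewrite mulf_neq0 ?oppr_eq0 ?invr_eq0.
apply: char2_same => //; apply: contraNneq ne => e.
exact/eqP/(factor_conj qmod3 inj e1 e2).
Qed.

End CharTwo.

(** * The classification *)

Local Close Scope ring_scope.

Theorem theorem1p1 (q : nat) (F : finFieldType) (hF : #|F| = q)
    (hq : q = 2 %[mod 3]) :
  connected_one_factorisation (complete3 (option F)) (chen_lu F) <->
  (q \in [:: 2; 5; 11]) \/ (exists p : nat, [/\ prime p, odd p & q = 2 ^ p]).
Proof.
subst q; have o0 := oner_neq0 F.
have mem a b : a != 0%R -> factor a b \in chen_lu F.
  by move=> a0; apply/chen_luP; exists a, b.
have conE : connected_one_factorisation (complete3 (option F)) (chen_lu F) <->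
    forall a b c d : F, a != 0%R -> c != 0%R -> factor a b != factor c d ->
      transitive2 a b c d.
  split=> [[_ con] a b c d a0 c0 ne|tr].
    by apply/(connected_transitive2 b d a0 c0)/con; rewrite ?mem.
  split=> [|M N]; first exact: chen_lu_factorisation.
  case/chen_luP=> a [b [a0 ->]] /chen_luP[c [d [c0 ->]]] ne.
  exact/connected_transitive2/tr.
rewrite conE; split=> [tr|]; last first.
  case=> [small|[p [pp _ q2]]] a b c d a0 c0 ne; first exact: small_transitive ne.
  exact: char2_transitive pp q2 hq _ _ _ _ a0 c0 ne.
have [two0|two_neq0] := eqVneq (2%:R : F)%R 0%R; last first.
  left; have q12 : #|F| < 12.
    rewrite ltnNge; apply/negP => q12.
    have [a [b [a0 ne nt]]] := tetrahedral_disconnected hq two_neq0 q12.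
    exact/nt/tr.
  have q8 : #|F| != 8.
    apply: contraNneq two_neq0 => e.
    by rewrite (pcharf0 (card_finPcharP (p := 2) (n := 3) e isT)).
  by move: hq q12 q8; case: #|F| => [|[|[|[|[|[|[|[|[|[|[|[|]]]]]]]]]]]].
have ch2 : 2 \in [pchar F]%R by rewrite inE /= two0 eqxx.
have [n n0 q2] := card_pchar ch2.
have n_odd : odd n.
  apply: contraT => /negPf n_even; move: hq; rewrite q2 -[n]odd_double_half n_even.
  by rewrite add0n -mul2n expnM -modnXm exp1n.
have [n1|n1] := eqVneq n 1; first by left; rewrite q2 n1.
right; exists n; split=> //; apply: contraT => /primePn[|[d /andP[d1 dn] dvd]].
  by case: n n0 n1 {q2 n_odd} => [|[|]].
have [b [ne nt]] := subline_disconnected hq q2 dvd d1 dn.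
by case: nt; apply: tr.
Qed.
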